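(* Let $m,n\ge 1$ be integers, $\theta\in\mathbb{R}^m$, $\lambda\in(0,1)$, $T\in\mathbb{R}^{n\times n}$ symmetric positive definite, $P_{-1}\in\mathbb{R}^{m\times m}$ symmetric positive definite, and let $\{\psi_k\}_{k\ge 0}$ be a sequence of matrices in $\mathbb{R}^{m\times n}$. Let $y_{k+1}=\psi_k^T\theta$ for $k\ge 0$, and let $(\hat\theta_k)_{k\ge 0}$ and $(P_k)_{k\ge -1}$ be generated, from an initial estimate $\hat\theta_0\in\mathbb{R}^m$ and from $P_{-1}$, by the recursive least squares algorithm with forgetting factor $$\hat\theta_{k+1}=\hat\theta_k+P_{k-1}\psi_kD_k^{-1}\left(y_{k+1}-\psi_k^T\hat\theta_k\right),\qquad P_k=\lambda^{-1}\left(I-P_{k-1}\psi_kD_k^{-1}\psi_k^T\right)P_{k-1},\qquad k\ge 0,$$ where $D_k=\lambda T+\psi_k^TP_{k-1}\psi_k$. Let $\tilde\theta_k=\theta-\hat\theta_k$ denote the estimation error. Suppose that $\{\psi_k\}$ is persistently exciting with window constant $S$. Then, for any initial condition $\tilde\theta_0$, the estimation error $\tilde\theta_k$ converges exponentially to $0$; that is, for any $\tilde\theta_0\in\mathbb{R}^m$ there exists $\gamma>0$ such that for all $k\ge S$ $$|\tilde\theta_k|^2\le\gamma\,\lambda^k\,|\tilde\theta_0|^2.$$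
   Context: Here $|\cdot|$ is the Euclidean norm, $I$ is the identity matrix of the appropriate size, and matrix inequalities are in the sense of the positive semidefinite (Loewner) order on symmetric matrices. The system is noise-free with measurable output $y_k\in\mathbb{R}^n$, regressor matrix $\psi_k\in\mathbb{R}^{m\times n}$ and constant unknown parameter vector $\theta\in\mathbb{R}^m$. The recursion for $P_k$ is equivalent to $P_k^{-1}=\lambda P_{k-1}^{-1}+\psi_kT^{-1}\psi_k^T$ for $k\ge 0$. Persistence of excitation: the matrix sequence $\{\psi_k\}_{k\ge0}$ is persistently exciting (with window constant $S$, a nonnegative integer) if there exist positive constants $\alpha$ and $\beta$ such that for all $j\ge 0$ $$0<\alpha I\le\sum_{i=j}^{j+S}\psi_i\psi_i^T\le\beta I<\infty.$$ *)

(* Defs.v *)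
From HB Require Import structures.
From mathcomp Require Import all_boot all_order all_algebra.
From mathcomp Require Import reals.
Set Implicit Arguments.
Unset Strict Implicit.
Unset Printing Implicit Defensive.
Import Order.TTheory GRing.Theory Num.Theory.
Local Open Scope ring_scope.

(* [`|x|] is avoided here: on matrices the library instance of the norm is the
   max norm. *)
Definition enorm (R : realType) (m : nat) (x : 'cV[R]_m) : R :=
  Num.sqrt (\sum_(i < m) x i 0 ^+ 2).

Definition qform (R : realType) (m : nat) (A : 'M[R]_m) (x : 'cV[R]_m) : R :=
  (x^T *m A *m x) 0 0.

Definition sym_posdef (R : realType) (m : nat) (A : 'M[R]_m) : Prop :=
  A^T = A /\ forall x : 'cV[R]_m, x != 0 -> 0 < qform A x.

Definition sym_possemidef (R : realType) (m : nat) (A : 'M[R]_m) : Prop :=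
  A^T = A /\ forall x : 'cV[R]_m, 0 <= qform A x.

Definition loewner_le (R : realType) (m : nat) (A B : 'M[R]_m) : Prop :=
  [/\ A^T = A, B^T = B & sym_possemidef (B - A)].

Definition persistently_exciting (R : realType) (m n : nat) (S : nat)
    (psi : nat -> 'M[R]_(m, n)) : Prop :=
  exists alpha beta : R, [/\ 0 < alpha, 0 < beta & forall j : nat,
    loewner_le alpha%:M (\sum_(j <= i < (j + S).+1) psi i *m (psi i)^T) /\
    loewner_le (\sum_(j <= i < (j + S).+1) psi i *m (psi i)^T) beta%:M].

(* D = lambda T + psi^T P psi; it is positive definite, so that [invmx] is its
   genuine inverse, whenever 0 < lambda, T is positive definite and P is
   positive semidefinite. *)
Definition rlsD (R : realType) (m n : nat) (lambda : R) (T : 'M[R]_n)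
    (P : 'M[R]_m) (psi : 'M[R]_(m, n)) : 'M[R]_n :=
  lambda *: T + psi^T *m P *m psi.

(* The sequence P_{-1}, P_0, P_1, ... is indexed from 0: [P k] stands for
   P_{k-1}, so [P 0] is the initial matrix P_{-1} and [P k.+1] is P_k. *)
Definition rls_forgetting (R : realType) (m n : nat) (lambda : R)
    (T : 'M[R]_n) (Pinit : 'M[R]_m) (psi : nat -> 'M[R]_(m, n))
    (y : nat -> 'cV[R]_n) (thetahat : nat -> 'cV[R]_m)
    (P : nat -> 'M[R]_m) : Prop :=
  [/\ P 0%N = Pinit,
      forall k : nat, thetahat k.+1 = thetahat k +
        P k *m psi k *m invmx (rlsD lambda T (P k) (psi k)) *m
          (y k.+1 - (psi k)^T *m thetahat k)
    & forall k : nat, P k.+1 = lambda^-1 *: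
        ((1%:M - P k *m psi k *m invmx (rlsD lambda T (P k) (psi k)) *m
            (psi k)^T) *m P k)].

(* Main.v *)
Require Import Defs.
From mathcomp Require Import all_boot all_order all_algebra.
From mathcomp Require Import reals.
From mathcomp Require Import ring lra.
Import Order.TTheory GRing.Theory Num.Theory.
Local Open Scope ring_scope.

(** The algorithm is linear in disguise.  Let [M_k] be the information matrix,
    the inverse of the covariance [P_k] (indexed as in [rls_forgetting]); it
    obeys [M_{k+1} = lambda M_k + psi_k T^-1 psi_k^T].  With
    [G_k = 1 - P_k psi_k D_k^-1 psi_k^T], the matrix inversion lemma takes the
    one-sided form [M_{k+1} G_k = lambda M_k] ([information_step]).  As the
    noise-free error satisfies [e_{k+1} = G_k e_k] and
    [P_{k+1} = lambda^-1 G_k P_k], this single identity gives both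
    [M_k P_k = 1] and the conserved quantity [M_k e_k = lambda^k M_0 e_0]
    ([rls_information_invariants]).

    It remains to invert [M_k] with uniform control, that is, to bound its
    quadratic form below by [c |x|^2] with [c > 0] independent of [k]
    ([information_lower_bound]).  Unrolling the recursion over a window of
    length [S + 1] keeps at least [lambda^(S+1)] times the excitation collected
    in it, which persistence of excitation bounds below; for [k <= S] the term
    [lambda^k M_0] suffices.  Then
    [c |e_k|^2 <= e_k^T M_k e_k = lambda^k e_k^T M_0 e_0] forces
    [|e_k|^2 <= lambda^(2k) |M_0 e_0|^2 / c^2], which is even better than the
    rate claimed. *)

(** * Quadratic forms *)

Section QuadraticForms.
Variable R : realType.

Lemma qformD m (A B : 'M[R]_m) x : qform (A + B) x = qform A x + qform B x.
Proof. by rewrite /qform mulmxDr mulmxDl mxE. Qed.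

Lemma qformZ m a (A : 'M[R]_m) x : qform (a *: A) x = a * qform A x.
Proof. by rewrite /qform -scalemxAr -scalemxAl mxE. Qed.

Lemma qformN m (A : 'M[R]_m) x : qform (- A) x = - qform A x.
Proof. by rewrite -scaleN1r qformZ mulN1r. Qed.

Lemma qform0l m (x : 'cV[R]_m) : qform 0 x = 0.
Proof. by rewrite /qform mulmx0 mul0mx mxE. Qed.

Lemma qform_sum m (s : seq nat) (A : nat -> 'M[R]_m) x :
  qform (\sum_(i <- s) A i) x = \sum_(i <- s) qform (A i) x.
Proof.
elim: s => [|i s IH]; first by rewrite !big_nil qform0l.
by rewrite !big_cons qformD IH.
Qed.

Lemma qform_congr m n (B : 'M[R]_(m, n)) (A : 'M[R]_n) x :
  qform (B *m A *m B^T) x = qform A (B^T *m x).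
Proof. by rewrite /qform trmx_mul trmxK !mulmxA. Qed.

Lemma qform0r m (A : 'M[R]_m) : qform A 0 = 0.
Proof. by rewrite /qform mulmx0 mxE. Qed.

Lemma qformZr m (A : 'M[R]_m) a x : qform A (a *: x) = a ^+ 2 * qform A x.
Proof.
rewrite /qform [(a *: x)^T]linearZ /= -scalemxAr -!scalemxAl scalerA.
by rewrite mxE expr2.
Qed.

Lemma enorm_sqr m (x : 'cV[R]_m) : enorm x ^+ 2 = qform 1%:M x.
Proof.
rewrite /enorm sqr_sqrtr; last by apply: sumr_ge0 => i _; rewrite sqr_ge0.
by rewrite /qform mulmx1 mxE; apply: eq_bigr => i _; rewrite mxE expr2.
Qed.

Lemma qform_scalar m a (x : 'cV[R]_m) : qform a%:M x = a * enorm x ^+ 2.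
Proof. by rewrite -scalemx1 qformZ enorm_sqr. Qed.

Lemma qformBr m (A : 'M[R]_m) x z : A^T = A ->
  qform A (x - z) = qform A x - 2 * (x^T *m (A *m z)) 0 0 + qform A z.
Proof.
move=> symA; have sw : (z^T *m (A *m x)) 0 0 = (x^T *m (A *m z)) 0 0.
  transitivity ((z^T *m (A *m x))^T 0 0); first by rewrite [RHS]mxE.
  by rewrite !trmx_mul trmxK symA mulmxA.
rewrite /qform -!mulmxA [(x - z)^T]linearB /= mulmxBr !mulmxBl !mulmxBr.
move: sw; rewrite !mxE => ->; ring.
Qed.

(** Bounding each [x_i x_j] by [|x|^2] costs only constants, and avoids any
    spectral theory. *)
Lemma qform_upper_bound m (A : 'M[R]_m) :
  exists2 C : R, 0 < C & forall x, qform A x <= C * enorm x ^+ 2.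
Proof.
have sum0 : 0 <= \sum_i \sum_j `|A j i|.
  by apply: sumr_ge0 => i _; apply: sumr_ge0.
exists (1 + \sum_i \sum_j `|A j i|); first lra.
move=> x; set N := enorm x ^+ 2.
have N0 : 0 <= N by exact: sqr_ge0.
have sqr_le i : x i 0 ^+ 2 <= N.
  rewrite /N /enorm sqr_sqrtr; last by apply: sumr_ge0 => j _; rewrite sqr_ge0.
  by rewrite (bigD1 i) //= lerDl; apply: sumr_ge0 => j _; rewrite sqr_ge0.
have prod_le i j : `|x i 0 * x j 0| <= N.
  rewrite ler_norml; have := sqr_le i; have := sqr_le j.
  have := sqr_ge0 (x i 0 + x j 0); have := sqr_ge0 (x i 0 - x j 0).
  by move=> ? ? ? ?; apply/andP; split; nra.
apply: le_trans (_ : (\sum_i \sum_j `|A j i|) * N <= _); last first.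
  by rewrite ler_wpM2r //; lra.
rewrite /qform mxE mulr_suml; apply: ler_sum => i _.
rewrite mxE !mulr_suml; apply: ler_sum => j _.
rewrite mxE -mulrA mulrCA (le_trans (ler_norm _)) // normrM.
by rewrite ler_wpM2l.
Qed.

Lemma posdef_unit m (A : 'M[R]_m) :
  (forall x, x != 0 -> 0 < qform A x) -> A \in unitmx.
Proof.
move=> posA; rewrite -unitmx_tr -row_free_unit -kermx_eq0.
apply/eqP/row_matrixP => i; rewrite row0; apply/eqP.
have ker : row i (kermx A^T) *m A^T = 0.
  by apply/sub_kermxP; exact: row_sub.
case: eqVneq => // nz; have nz' : (row i (kermx A^T))^T != 0.
  by rewrite trmx_eq0.
have kerT : A *m (row i (kermx A^T))^T = 0.
  by rewrite -[LHS]trmxK trmx_mul trmxK ker trmx0.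
by have := posA _ nz'; rewrite /qform -mulmxA kerT mulmx0 mxE ltxx.
Qed.

Lemma posdef_ge0 m (A : 'M[R]_m) : sym_posdef A -> forall x, 0 <= qform A x.
Proof.
case=> _ posA x; case: (eqVneq x 0) => [->|/posA /ltW //].
by rewrite qform0r.
Qed.

Lemma sym_posdef_inv m (A : 'M[R]_m) : sym_posdef A -> sym_posdef (invmx A).
Proof.
case=> symA posA; have uA := posdef_unit _ _ posA.
have symI : (invmx A)^T = invmx A by rewrite trmx_inv symA.
split=> // x nzx; have eqI : invmx A = invmx A *m A *m (invmx A)^T.
  by rewrite mulVmx // mul1mx symI.
rewrite eqI qform_congr symI; apply: posA.
by apply: contraNneq nzx => Ix0; rewrite -(mulKVmx uA x) Ix0 mulmx0.
Qed.

(** Positivity of the form at [x - s A^-1 x] reads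
    [2 s |x|^2 <= x^T A x + s^2 x^T A^-1 x]; an upper bound [C |x|^2] for the
    form of [A^-1] and the choice [s = 1 / C] give the lower bound [1 / C],
    without any appeal to compactness of the sphere or to eigenvalues. *)
Lemma posdef_lower_bound m (A : 'M[R]_m) : sym_posdef A ->
  exists2 c : R, 0 < c & forall x, c * enorm x ^+ 2 <= qform A x.
Proof.
move=> pdA; have [symA posA] := pdA; have uA := posdef_unit _ _ posA.
have [C C0 leC] := qform_upper_bound _ (invmx A).
exists C^-1 => [|x]; first by rewrite invr_gt0.
have := posdef_ge0 _ _ pdA (x - C^-1 *: (invmx A *m x)).
rewrite qformBr // -scalemxAr mulKVmx // -scalemxAr.
have -> : qform A (C^-1 *: (invmx A *m x)) = C^-1 ^+ 2 * qform (invmx A) x.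
  rewrite qformZr /qform trmx_mul trmx_inv symA.
  by rewrite mulmxKV // mulmxA.
have -> : (C^-1 *: (x^T *m x)) 0 0 = C^-1 * enorm x ^+ 2.
  by rewrite enorm_sqr /qform mulmx1 mxE.
have : C^-1 ^+ 2 * qform (invmx A) x <= C^-1 * enorm x ^+ 2.
  have -> : C^-1 * enorm x ^+ 2 = C^-1 ^+ 2 * (C * enorm x ^+ 2).
    by field; rewrite gt_eqF.
  by rewrite ler_wpM2l ?sqr_ge0.
lra.
Qed.

(** Expanding [0 <= |c x - w|^2] replaces the Cauchy-Schwarz inequality in the
    step from [c |x|^2 <= x^T M x = x^T w] to [c |x| <= |w|]. *)
Lemma enorm_le_of_coercive m (M : 'M[R]_m) c x : 0 < c ->
  c * enorm x ^+ 2 <= qform M x ->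
  c ^+ 2 * enorm x ^+ 2 <= enorm (M *m x) ^+ 2.
Proof.
move=> c0 coer; set w := M *m x.
have qw : qform M x = (x^T *m w) 0 0 by rewrite /qform mulmxA.
have := sqr_ge0 (enorm (w - c *: x)).
rewrite [enorm (w - _) ^+ 2]enorm_sqr qformBr ?trmx1 // mul1mx -scalemxAr.
have -> : (c *: (w^T *m x)) 0 0 = c * (x^T *m w) 0 0.
  by rewrite mxE -[w in RHS]trmxK -trmx_mul [in RHS]mxE.
have -> : qform 1%:M (c *: x) = c ^+ 2 * enorm x ^+ 2.
  by rewrite qformZr enorm_sqr.
have := ler_wpM2l (ltW c0) coer.
rewrite -enorm_sqr qw mulrA -expr2; lra.
Qed.

End QuadraticForms.

(** * The information matrix *)

Section Information.
Variables (R : realType) (m n : nat) (lambda : R) (T : 'M[R]_n).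
Hypotheses (lambda_gt0 : 0 < lambda) (pdT : sym_posdef T).

Fixpoint information (M0 : 'M[R]_m) (psi : nat -> 'M[R]_(m, n)) (k : nat) :=
  if k is j.+1
  then lambda *: information M0 psi j + psi j *m invmx T *m (psi j)^T
  else M0.

(** After expansion, writing [psi^T P psi] as [D - lambda T] cancels all terms
    but [lambda M]. *)
Lemma information_step (M P : 'M[R]_m) (p : 'M[R]_(m, n)) :
  M *m P = 1%:M -> rlsD lambda T P p \in unitmx ->
  (lambda *: M + p *m invmx T *m p^T) *m
    (1%:M - P *m p *m invmx (rlsD lambda T P p) *m p^T) = lambda *: M.
Proof.
move=> MP uD; set D := rlsD lambda T P p in uD *.
have uT := posdef_unit _ _ _ pdT.2.
have pPp : p^T *m P *m p = D - lambda *: T by rewrite /D /rlsD addrC addKr.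
rewrite mulmxBr mulmx1 mulmxDl -scalemxAl !mulmxA MP mul1mx.
have -> : p *m invmx T *m p^T *m P *m p *m invmx D *m p^T =
          p *m invmx T *m (p^T *m P *m p) *m invmx D *m p^T.
  by rewrite !mulmxA.
rewrite pPp mulmxBr -scalemxAr mulmxKV // !mulmxBl mulmxK //.
by rewrite -!scalemxAl addrCA subrr addr0 addrK.
Qed.

Lemma rlsD_unit (P : 'M[R]_m) (p : 'M[R]_(m, n)) :
  sym_posdef P -> rlsD lambda T P p \in unitmx.
Proof.
move=> pdP; apply: posdef_unit => x nzx.
rewrite /rlsD qformD qformZ.
have -> : p^T *m P *m p = p^T *m P *m p^T^T by rewrite trmxK.
rewrite qform_congr ltr_pwDl ?posdef_ge0 // mulr_gt0 //.
exact: pdT.2.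
Qed.

Lemma information_posdef M0 psi k :
  sym_posdef M0 -> sym_posdef (information M0 psi k).
Proof.
move=> pd0; have pdTi := sym_posdef_inv _ _ _ pdT.
elim: k => [|k [symM posM]] //=; split.
  by rewrite linearD linearZ /= symM !trmx_mul trmxK pdTi.1 mulmxA.
move=> x nzx; rewrite qformD qformZ qform_congr ltr_pwDl ?posdef_ge0 //.
by rewrite mulr_gt0 // posM.
Qed.

(** The first invariant is what makes [information_step] applicable to [P_k] at
    the next stage, through the positive definiteness of [P_k = M_k^-1]; the
    second says that the error in information coordinates decays by exactly
    [lambda] at each step. *)
Lemma rls_information_invariants Pinit psi y theta thetahat P k :
  sym_posdef Pinit -> (forall j, y j.+1 = (psi j)^T *m theta) ->
  rls_forgetting lambda T Pinit psi y thetahat P ->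
  let M := information (invmx Pinit) psi in
  M k *m P k = 1%:M /\
  M k *m (theta - thetahat k) =
    lambda ^+ k *: (M 0%N *m (theta - thetahat 0%N)).
Proof.
move=> pdP0 hy [P0 thS PS] M; have pdM j : sym_posdef (M j).
  by apply: information_posdef; exact: sym_posdef_inv.
elim: k => [|k [MP Me]].
  by rewrite expr0 scale1r P0 mulVmx //; exact: posdef_unit pdP0.2.
have pdP : sym_posdef (P k).
  have uM := posdef_unit _ _ _ (pdM k).2.
  by rewrite -[P k](mulKmx uM) MP mulmx1; exact: sym_posdef_inv.
have step := information_step _ _ _ MP (rlsD_unit _ (psi k) pdP).
have errS : theta - thetahat k.+1 =
    (1%:M - P k *m psi k *m invmx (rlsD lambda T (P k) (psi k)) *m
       (psi k)^T) *m (theta - thetahat k).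
  rewrite thS hy -mulmxBr [RHS]mulmxBl mul1mx opprD addrA.
  by rewrite -!mulmxA.
split.
  rewrite PS -scalemxAr mulmxA [M k.+1]/= step -scalemxAl scalerA.
  by rewrite mulVf ?gt_eqF // scale1r.
by rewrite errS mulmxA [M k.+1]/= step -scalemxAl Me scalerA exprS.
Qed.

(** Discounting the whole window by its last factor [lambda^l] is crude, but
    makes the accumulated excitation appear undiscounted, as in the definition
    of persistent excitation. *)
Lemma information_window M0 psi t : lambda <= 1 ->
  (forall z, t * enorm z ^+ 2 <= qform (invmx T) z) -> 0 <= t ->
  forall j l x,
    lambda ^+ l * (qform (information M0 psi j) x +
      t * qform (\sum_(j <= i < j + l) psi i *m (psi i)^T) x)
    <= qform (information M0 psi (j + l)) x.
Proof.
move=> lambda1 leT t0 j l x; elim: l => [|l IH].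
  by rewrite addn0 big_geq // expr0 mul1r qform0l mulr0 addr0.
rewrite addnS big_nat_recr ?leq_addr //= !qformD qformZ qform_congr.
have -> : qform (psi (j + l)%N *m (psi (j + l)%N)^T) x =
          enorm ((psi (j + l)%N)^T *m x) ^+ 2.
  by rewrite enorm_sqr -qform_congr mulmx1.
have {}leT := leT ((psi (j + l)%N)^T *m x).
set E := enorm _ ^+ 2 in leT *.
have tE : 0 <= t * E by rewrite mulr_ge0 // sqr_ge0.
have le1 : lambda ^+ l.+1 * (t * E) <= t * E.
  by rewrite ler_piMl // exprn_ile1 // ltW.
have := ler_wpM2l (ltW lambda_gt0) IH.
rewrite mulrA -exprS; lra.
Qed.

Lemma information_lower_bound M0 psi S :
  lambda <= 1 -> sym_posdef M0 -> persistently_exciting S psi ->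
  exists2 c : R, 0 < c &
    forall k x, c * enorm x ^+ 2 <= qform (information M0 psi k) x.
Proof.
move=> lambda1 pd0 [alpha [beta [alpha0 _ PE]]].
have [t t0 leT] := posdef_lower_bound _ _ _ (sym_posdef_inv _ _ _ pdT).
have [p p0 leM0] := posdef_lower_bound _ _ _ pd0.
have win := information_window M0 psi t lambda1 leT (ltW t0).
have ta0 : 0 < t * alpha by rewrite mulr_gt0.
exists (lambda ^+ S.+1 * Num.min p (t * alpha)).
  by rewrite mulr_gt0 ?exprn_gt0 // lt_min p0.
move=> k x; have N0 : 0 <= enorm x ^+ 2 by exact: sqr_ge0.
rewrite -mulrA; have [kS|Sk] := leqP k S.
  have := win 0%N k x; rewrite add0n => /(le_trans _); apply.
  apply: ler_pM; first by rewrite exprn_ge0 ?ltW.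
  - by rewrite mulr_ge0 // ltW // lt_min p0.
  - by apply: ler_wiXn2l; rewrite ?leqW // ltW.
  apply: le_trans (_ : p * enorm x ^+ 2 <= _).
    by rewrite ler_wpM2r // ge_min lexx.
  rewrite (le_trans (leM0 x)) // lerDl mulr_ge0 ?(ltW t0) //.
  rewrite qform_sum sumr_ge0 // => i _.
  by rewrite -[X in X *m _]mulmx1 qform_congr -enorm_sqr sqr_ge0.
have [[_ _ [_ PEk]] _] := PE (k - S.+1)%N.
have := win (k - S.+1)%N S.+1 x; rewrite subnK // => /(le_trans _); apply.
rewrite ler_wpM2l ?exprn_ge0 ?(ltW lambda_gt0) //.
apply: le_trans (_ : t * alpha * enorm x ^+ 2 <= _).
  by rewrite ler_wpM2r // ge_min lexx orbT.
have := PEk x; rewrite -addnS subnK // qformD qformN qform_scalar subr_ge0.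
move=> /(ler_wpM2l (ltW t0)); rewrite mulrA => /le_trans -> //.
by rewrite lerDr posdef_ge0 //; exact: information_posdef.
Qed.

End Information.

(** * Convergence of the estimation error *)

Theorem theorem3 (R : realType) (m n : nat) (hm : (1 <= m)%N) (hn : (1 <= n)%N)
    (theta : 'cV[R]_m) (lambda : R) (hlambda0 : 0 < lambda)
    (hlambda1 : lambda < 1)
    (T : 'M[R]_n) (hT : sym_posdef T)
    (Pinit : 'M[R]_m) (hPinit : sym_posdef Pinit)
    (psi : nat -> 'M[R]_(m, n))
    (y : nat -> 'cV[R]_n) (hy : forall k : nat, y k.+1 = (psi k)^T *m theta)
    (S : nat) (hPE : persistently_exciting S psi)
    (thetahat : nat -> 'cV[R]_m) (P : nat -> 'M[R]_m)
    (hrls : rls_forgetting lambda T Pinit psi y thetahat P) :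
  exists gamma : R, 0 < gamma /\
    forall k : nat, (S <= k)%N ->
      enorm (theta - thetahat k) ^+ 2 <=
        gamma * lambda ^+ k * enorm (theta - thetahat 0%N) ^+ 2.
Proof.
set e := fun k => theta - thetahat k; set M0 := invmx Pinit.
have pdM0 : sym_posdef M0 by exact: sym_posdef_inv.
have [c c0 coer] :=
  information_lower_bound _ _ _ _ _ hlambda0 hT _ _ _ (ltW hlambda1) pdM0 hPE.
have [C C0 leC] := qform_upper_bound _ _ (M0^T *m M0).
exists (C / c ^+ 2); split; first by rewrite divr_gt0 ?exprn_gt0.
move=> k _; have c2 : 0 < c ^+ 2 by rewrite exprn_gt0.
have [_ Mek] := rls_information_invariants _ _ _ _ _ hlambda0 hT
  _ _ _ _ _ _ k hPinit hy hrls.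
have := enorm_le_of_coercive _ _ _ _ _ c0 (coer k (e k)).
rewrite Mek.
have -> : enorm (lambda ^+ k *: (M0 *m e 0%N)) ^+ 2 =
    lambda ^+ k ^+ 2 * qform (M0^T *m M0) (e 0%N).
  by rewrite enorm_sqr qformZr /qform mulmx1 trmx_mul !mulmxA.
set l := lambda ^+ k; have l0 : 0 <= l by rewrite exprn_ge0 // ltW.
have l1 : l ^+ 2 <= l.
  by rewrite expr2 ler_piMl // exprn_ile1 // ltW.
move=> le1; rewrite -(ler_pM2l c2) (le_trans le1) //.
have -> : c ^+ 2 * (C / c ^+ 2 * l * enorm (e 0%N) ^+ 2) =
          l * (C * enorm (e 0%N) ^+ 2) by field; rewrite gt_eqF.
apply: le_trans (_ : l ^+ 2 * (C * enorm (e 0%N) ^+ 2) <= _).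
  by rewrite ler_wpM2l ?sqr_ge0.
by rewrite ler_wpM2r // mulr_ge0 ?(ltW C0) // sqr_ge0.
Qed.
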